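(* Let $n\ge 3$ and $k$ be positive integers with $n\ge k+\lceil n/3\rceil$. For the cycle graph $C_n$, $$Sb_k(C_n)=\begin{cases}\left\lfloor\frac{3k+1}{2}\right\rfloor+1, & n\equiv 1\pmod 3,\\[2pt] \left\lceil\frac{3k-1}{2}\right\rceil+1, & n\equiv 2\pmod 3,\\[2pt] \left\lfloor\frac{3k-1}{2}\right\rfloor+1, & n\equiv 0\pmod 3.\end{cases}$$
   Context: $\gamma(G)$ is the domination number of $G$ (minimum size of a dominating set); $\gamma(C_n)=\lceil n/3\rceil$. For a positive integer $k$, $Sb_k(G)$ is the minimum size of a set $\mathcal{E}$ of edges of $G$ such that $\gamma(G-\mathcal{E})=\gamma(G)+k$. *)

(* Defs.v *)
From mathcomp Require Import all_boot.
Set Implicit Arguments.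
Unset Strict Implicit.
Unset Printing Implicit Defensive.

Record sgraph := SGraph {
  vertex :> finType;
  adj : rel vertex;
  adj_sym : symmetric adj;
  adj_irr : irreflexive adj }.

Definition edges (G : sgraph) : {set {set G}} :=
  [set [set p.1; p.2] | p : G * G & adj p.1 p.2].

(* Elements of E that are not edges of G have no effect. *)
Definition del_rel (G : sgraph) (E : {set {set G}}) : rel G :=
  fun x y => adj x y && ([set x; y] \notin E).

Lemma del_rel_sym (G : sgraph) (E : {set {set G}}) : symmetric (del_rel E).
Proof. by move=> x y; rewrite /del_rel adj_sym setUC. Qed.

Lemma del_rel_irr (G : sgraph) (E : {set {set G}}) : irreflexive (del_rel E).
Proof. by move=> x; rewrite /del_rel adj_irr. Qed.

Definition del_edges (G : sgraph) (E : {set {set G}}) : sgraph :=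
  SGraph (del_rel_sym E) (@del_rel_irr G E).

Definition dominating (G : sgraph) (D : {set G}) : bool :=
  [forall v, (v \in D) || [exists u in D, adj u v]].

Lemma dominatingT (G : sgraph) : dominating [set: G].
Proof. by apply/forallP => v; rewrite inE. Qed.

Definition domination_number (G : sgraph) : nat :=
  #|[arg min_(D < [set: G] | dominating D) #|D|]|.

Lemma domination_numberP (G : sgraph) :
  (exists2 D : {set G}, dominating D & #|D| = domination_number G) /\
  (forall D : {set G}, dominating D -> domination_number G <= #|D|).
Proof.
rewrite /domination_number; case: arg_minnP => [|D domD minD].
  exact: dominatingT.
by split=> //; exists D.
Qed.

Definition raises_domination (k : nat) (G : sgraph) (E : {set {set G}}) : bool :=
  (E \subset edges G) &&
  (domination_number (del_edges E) == domination_number G + k).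

(* None when no set of edges raises the domination number by exactly k. *)
Definition Sb (k : nat) (G : sgraph) : option nat :=
  if [pick E | raises_domination k (G := G) E] is Some E0
  then Some #|[arg min_(E < E0 | raises_domination k (G := G) E) #|E|]|
  else None.

Lemma SbP (k : nat) (G : sgraph) (m : nat) :
  Sb k G = Some m <->
  (exists2 E : {set {set G}}, raises_domination k E & #|E| = m) /\
  (forall E : {set {set G}}, raises_domination k E -> m <= #|E|).
Proof.
rewrite /Sb; case: pickP => [E0 rE0|nE]; last first.
  by split=> // -[[E rE _] _]; rewrite nE in rE.
case: arg_minnP => // E1 rE1 minE1; split=> [[<-]|[[E rE <-] minE]].
  by split=> //; exists E1.
by congr Some; apply/eqP; rewrite eqn_leq minE1 ?minE.
Qed.

(* The cycle 0, 1, ..., n-1, 0, meant for n >= 3; ordS x is x + 1 modulo n.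
   The condition x != y only excludes the loop that n = 1 would give. *)
Definition cycle_rel (n : nat) : rel 'I_n :=
  fun x y => (x != y) && ((ordS x == y) || (ordS y == x)).

Lemma cycle_rel_sym (n : nat) : symmetric (@cycle_rel n).
Proof. by move=> x y; rewrite /cycle_rel eq_sym orbC. Qed.

Lemma cycle_rel_irr (n : nat) : irreflexive (@cycle_rel n).
Proof. by move=> x; rewrite /cycle_rel eqxx. Qed.

Definition cycle_graph (n : nat) : sgraph :=
  SGraph (@cycle_rel_sym n) (@cycle_rel_irr n).

Definition ceil_divn (m d : nat) : nat := (m + d.-1) %/ d.

Lemma ceil_divnP (m d q : nat) : 0 < d -> (ceil_divn m d <= q) = (m <= q * d).
Proof.
case: d => // d _.
by rewrite /ceil_divn -ltnS ltn_divLR // mulSn addSn addnC ltnS leq_add2l.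
Qed.

(* Main.v *)
(** Label the vertices of the cycle consecutively, starting just after a deleted
    edge, and let [D_j] be the set of vertices with label [j] modulo 3.  For each
    deleted edge, each of its two endpoints may fail to be dominated by [D_j], but
    for a single residue [j] only.  After adding these exceptions the three sets
    [D_0], [D_1], [D_2] are dominating, with total size at most [n + 2m] where [m]
    is the number of deleted edges; hence [3 * gamma <= n + 2m].  Conversely,
    deleting [m] consecutive edges isolates [m - 1] vertices, which lie in every
    dominating set, and every other vertex dominates at most 3 vertices; hence
    [n + 2(m - 1) <= 3 * gamma]. *)
Require Import Defs.
From mathcomp Require Import all_boot.
From mathcomp Require Import zify.
Set Implicit Arguments.
Unset Strict Implicit.
Unset Printing Implicit Defensive.

Lemma dominatingP (G : sgraph) (D : {set G}) :
  reflect (forall v, v \notin D -> exists2 u, u \in D & adj u v)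
          (dominating D).
Proof.
apply: (iffP forallP) => [domD v vD | domD v].
  by have := domD v; rewrite (negPf vD) => /existsP[u /andP[]]; exists u.
case: (boolP (v \in D)) => //= vD.
by apply/existsP; have [u uD uv] := domD v vD; exists u; rewrite uD.
Qed.

Lemma domination_number_del0 (G : sgraph) :
  domination_number (del_edges (G := G) set0) = domination_number G.
Proof.
have eqdom (D : {set G}) : dominating (G := del_edges set0) D = dominating D.
  apply: eq_forallb => v; congr orb; apply: eq_existsb => u.
  by rewrite /adj /= /del_rel inE andbT.
have [[D domD cardD] minD] := domination_numberP G.
have [[D' domD' cardD'] minD'] := domination_numberP (del_edges (G := G) set0).
apply/eqP; rewrite eqn_leq; apply/andP; split.
  by rewrite -cardD; apply: minD'; rewrite eqdom.
by rewrite -cardD'; apply: minD; rewrite -eqdom.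
Qed.

(** The isolated vertices lie in every dominating set [D], and the others are covered by the closed
    neighbourhoods of [D :\: I], each of size at most [d.+1]. *)
Lemma domination_number_isolated_ge (G : sgraph) (d : nat) (I : {set G}) :
    (forall u : G, #|[set v | adj u v]| <= d) ->
    (forall u v : G, u \in I -> ~~ adj u v) ->
  #|G| + d * #|I| <= d.+1 * domination_number G.
Proof.
move=> degG isoI; have [[D /dominatingP domD <-] _] := domination_numberP G.
have subI : I \subset D.
  apply/subsetP => v vI; case: (boolP (v \in D)) => // /domD[u _].
  by rewrite adj_sym (negPf (isoI v u vI)).
have cover : ~: I \subset \bigcup_(u in D :\: I) (u |: [set v | adj u v]).
  apply/subsetP => v; rewrite inE => vI; apply/bigcupP.
  case: (boolP (v \in D)) => [vD | /domD[u uD uv]].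
    by exists v; rewrite !inE ?vI ?eqxx.
  exists u; rewrite !inE ?uv ?orbT ?uD ?andbT //.
  by apply/negP => /(isoI u v); rewrite uv.
have cardCI : #|~: I| <= d.+1 * #|D :\: I|.
  apply: leq_trans (subset_leq_card cover) _.
  apply: (@leq_trans (\sum_(u in D :\: I) #|u |: [set v | adj u v]|)).
    elim/big_rec2: _ => [|u m A _ leAm]; first by rewrite cards0.
    by apply: leq_trans (leq_card_setU _ _) _; rewrite leq_add2l.
  rewrite mulnC -sum_nat_const; apply: leq_sum => u _.
  by rewrite cardsU1 -add1n leq_add // leq_b1.
have := cardsC I; have := cardsID I D; rewrite (setIidPr subI).
nia.
Qed.

Lemma card_modn3 (T : finType) (A : {set T}) (f : T -> nat) :
  #|[set x in A | f x == 0 %[mod 3]]| + #|[set x in A | f x == 1 %[mod 3]]| +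
    #|[set x in A | f x == 2 %[mod 3]]| = #|A|.
Proof.
rewrite -[RHS]sum1_card.
pose r x := Ordinal (ltn_pmod (f x) (isT : 0 < 3)).
rewrite (partition_big r xpredT) //=.
rewrite !big_ord_recl big_ord0 addn0 addnA.
congr (_ + _ + _); rewrite -sum1_card; apply: eq_bigl => x.
all: by rewrite inE -val_eqE.
Qed.

Section Cycle.

Variable n : nat.
Hypothesis n_ge3 : 3 <= n.

Definition cycle_edge (x : 'I_n) : {set 'I_n} := [set x; ordS x].

Lemma ordS_neq (x : 'I_n) : x != ordS x.
Proof.
rewrite -val_eqE /=; have := ltn_ord x; case: (ltnP x.+1 n) => ltxn ltx.
  rewrite modn_small //; lia.
have -> : x.+1 = n by lia.
rewrite modnn; lia.
Qed.

Lemma ordSS_neq (x : 'I_n) : ordS (ordS x) != x.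
Proof.
rewrite -val_eqE /=; have := ltn_ord x; case: (ltnP x.+1 n) => ltxn ltx.
  rewrite (modn_small ltxn); case: (ltnP x.+2 n) => [ltx2|leqn].
    rewrite modn_small //; lia.
  have -> : x.+2 = n by lia.
  rewrite modnn; lia.
have -> : x.+1 = n by lia.
rewrite modnn modn_small; lia.
Qed.

(** Two distinct vertices with the same edge would each be the successor of the other, which [n_ge3]
    excludes. *)
Lemma cycle_edge_inj : injective cycle_edge.
Proof.
move=> x y /setP exy.
have := exy x; rewrite !inE eqxx /= => /esym/orP[/eqP // | /eqP xSy].
have := exy y; rewrite !inE eqxx /= => /orP[/eqP // | /eqP ySx].
by have := ordSS_neq x; rewrite -ySx -xSy eqxx.
Qed.

Lemma cycle_rel_ordS (x : 'I_n) : cycle_rel x (ordS x).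
Proof. by rewrite /cycle_rel ordS_neq eqxx. Qed.

Lemma cycle_edge_edges (x : 'I_n) : cycle_edge x \in edges (cycle_graph n).
Proof.
by apply/imsetP; exists (x, ordS x); rewrite ?inE //=; apply: cycle_rel_ordS.
Qed.

Lemma card_del_cycle_nbr (E : {set {set cycle_graph n}}) (u : del_edges E) :
  #|[set v | adj u v]| <= 2.
Proof.
apply: (@leq_trans #|[set ordS u; ord_pred u]|); last first.
  by rewrite cards2 ltnS leq_b1.
apply/subset_leq_card/subsetP => v; rewrite !inE.
case/andP => /andP[_ /orP[/eqP<- | /eqP<-]] _; first by rewrite eqxx.
by rewrite ordSK eqxx orbT.
Qed.

Lemma consecutive_labels (c : 'I_n) :
  exists f : 'I_n -> nat, forall x, x != c -> f (ordS x) = (f x).+1.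
Proof.
(* From the successor of [c] around to [c], the labels are c+1, ..., n-1, n, ..., n+c. *)
exists (fun x => if x <= c then x + n else x) => x; rewrite -val_eqE /= => xc.
have ltx := ltn_ord x; have ltc := ltn_ord c.
case: (ltnP x.+1 n) => ltxn.
  rewrite (modn_small ltxn).
  by case: (leqP x c) => ?; case: (leqP x.+1 c) => ?; lia.
have -> : x.+1 = n by lia.
rewrite modnn leq0n; case: (leqP x c) => ?; lia.
Qed.

(** [S] may exceed the set of deleted edges: the break [c] of the labelling counts as a cut even if
    its edge remains. *)
Lemma domination_number_del_cycle_le_cuts (E : {set {set cycle_graph n}})
    (S : {set 'I_n}) (c : 'I_n) :
    c \in S -> (forall x, cycle_edge x \in E -> x \in S) ->
  3 * domination_number (del_edges E) <= n + 2 * #|S|.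
Proof.
move=> cS cutS; have [f fS] := consecutive_labels c.
have [_ minD] := domination_numberP (del_edges E).
pose A (j : nat) := [set x : 'I_n in setT | f x == j %[mod 3]].
(* [B j] and [C j] collect the endpoints of cuts whose lost successor, respectively predecessor,
   would have had label [j] modulo 3; adding 2 stands for subtracting 1. *)
pose B (j : nat) := [set x : 'I_n in S | f x + 1 == j %[mod 3]].
pose C (j : nat) := [set x : 'I_n in @ordS n @: S | f x + 2 == j %[mod 3]].
have nextS x : x \notin S -> f (ordS x) = (f x).+1.
  by move=> xS; apply: fS; apply: contraNneq xS => ->.
have adjS x : x \notin S -> adj (s := del_edges E) x (ordS x).
  move=> xS; apply/andP; split; first exact: cycle_rel_ordS.
  by apply: contra xS; apply: cutS.
have domD (j : nat) : dominating (G := del_edges E) (A j :|: B j :|: C j).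
  apply/dominatingP => v; rewrite !inE /= !negb_or => /andP[/andP[vA vB] vC].
  have [vB' | vB'] := boolP (f v + 1 == j %[mod 3]).
    have vS : v \notin S by move: vB; rewrite vB' andbT.
    exists (ordS v); first by rewrite !inE nextS // -addn1 vB'.
    exact: etrans (adj_sym _ _) (adjS _ vS).
  have vC' : f v + 2 == j %[mod 3] by clear -vA vB'; lia.
  have vS : ord_pred v \notin S.
    apply: contra vC => pvS; rewrite vC' andbT.
    by apply/imsetP; exists (ord_pred v); rewrite ?ord_predK.
  exists (ord_pred v); last by have := adjS _ vS; rewrite ord_predK.
  have := nextS _ vS; rewrite ord_predK => fv.
  have vA' : f (ord_pred v) == j %[mod 3] by move: vC'; rewrite fv; lia.
  by rewrite !inE vA'.
have leD (j : nat) :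
    domination_number (del_edges E) <= #|A j| + #|B j| + #|C j|.
  apply: leq_trans (minD _ (domD j)) _.
  apply: leq_trans (leq_card_setU _ _) _.
  by rewrite leq_add2r leq_card_setU.
have sumA : #|A 0| + #|A 1| + #|A 2| = n by rewrite card_modn3 cardsT card_ord.
have sumB : #|B 0| + #|B 1| + #|B 2| = #|S| by rewrite card_modn3.
have sumC : #|C 0| + #|C 1| + #|C 2| = #|S|.
  by rewrite card_modn3 (card_imset _ (@ordS_inj n)).
have := leD 0; have := leD 1; have := leD 2; lia.
Qed.

(** The [maxn 1] pays for the one cut that the labelling needs when no edge is deleted. *)
Lemma domination_number_del_cycle_le (E : {set {set cycle_graph n}}) :
  3 * domination_number (del_edges E) <= n + 2 * maxn 1 #|E|.
Proof.
pose S := [set x : 'I_n | cycle_edge x \in E].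
have [S0 | [c cS]] := set_0Vmem S.
  have c : 'I_n := Ordinal (leq_trans (isT : 0 < 3) n_ge3).
  apply: (@leq_trans (n + 2 * #|[set c]|)); last by rewrite cards1; lia.
  apply: (domination_number_del_cycle_le_cuts (set11 c)) => x xE.
  by have : x \in S by [rewrite inE]; rewrite S0 inE.
have leSE : #|S| <= #|E|.
  rewrite -(card_imset _ cycle_edge_inj); apply/subset_leq_card/subsetP.
  by move=> _ /imsetP[x xS ->]; rewrite inE in xS.
apply: (@leq_trans (n + 2 * #|S|)); last by lia.
by apply: domination_number_del_cycle_le_cuts cS _ => x; rewrite inE.
Qed.

Lemma cut_consecutive_edges (m : nat) : 0 < m <= n ->
  exists E : {set {set cycle_graph n}},
    [/\ E \subset edges (cycle_graph n), #|E| = m &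
        n + 2 * m.-1 <= 3 * domination_number (del_edges E)].
Proof.
case: m => // m lemn; pose w := widen_ord lemn.
have w_inj : injective w by move=> i j /(congr1 val) /= /val_inj.
pose E : {set {set cycle_graph n}} := [set cycle_edge (w i) | i : 'I_m.+1].
have cutE (x : 'I_n) : x < m.+1 -> cycle_edge x \in E.
  move=> ltx; apply/imsetP; exists (Ordinal ltx) => //.
  by congr cycle_edge; apply: val_inj.
(* The edges leaving 0, ..., m are deleted, so 1, ..., m lose both their edges. *)
pose I : {set 'I_n} := [set w (lift ord0 i) | i : 'I_m].
exists E; split.
- by apply/subsetP => _ /imsetP[i _ ->]; apply: cycle_edge_edges.
- by rewrite card_imset ?card_ord // => i j /cycle_edge_inj/w_inj.
- have cardI : #|I| = m.
    by rewrite card_imset ?card_ord // => i j /w_inj/lift_inj.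
  rewrite -{1}(card_ord n) -[m.+1.-1]cardI.
  apply: domination_number_isolated_ge; first exact: card_del_cycle_nbr.
  move=> u v /imsetP[i _ def_u]; rewrite /adj /= /del_rel.
  have u_gt0 : 0 < u by rewrite def_u.
  have ltu : u < m.+1 by rewrite def_u; apply: ltn_ord (lift ord0 i).
  apply/negP => /andP[/andP[_ /orP[/eqP Su | /eqP Sv]]] /negP; apply.
    by rewrite -Su; apply: cutE.
  rewrite -Sv setUC; apply: cutE.
  move: u_gt0 ltu; rewrite -Sv /=; have := ltn_ord v.
  case: (ltnP v.+1 n) => [ltv _ | lev ltv].
    by rewrite modn_small // => _ /ltnW.
  (* Here the successor [u] of [v] would be 0, against [u_gt0]. *)
  have -> : v.+1 = n by apply/eqP; rewrite eqn_leq ltv lev.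
  by rewrite modnn.
Qed.

(** The case of no deleted edges; it pins the domination number to the ceiling of n/3. *)
Lemma domination_number_cycle_bounds :
  n <= 3 * domination_number (cycle_graph n) <= n + 2.
Proof.
rewrite -domination_number_del0; apply/andP; split.
  pose G0 := del_edges (G := cycle_graph n) set0.
  have := @domination_number_isolated_ge G0 2 set0 (@card_del_cycle_nbr set0).
  rewrite cards0 muln0 addn0 [#|_|]card_ord; apply=> u v.
  by rewrite inE.
by have := domination_number_del_cycle_le set0; rewrite cards0.
Qed.

End Cycle.

Theorem theorem8 (n k : nat) (hn : 3 <= n) (hk : 0 < k)
  (hnk : k + ceil_divn n 3 <= n) :
  Sb k (cycle_graph n) =
  Some (if n %% 3 == 1 then (3 * k + 1) %/ 2 + 1
        else if n %% 3 == 2 then ceil_divn (3 * k - 1) 2 + 1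
        else (3 * k - 1) %/ 2 + 1).
Proof.
set m := (X in Some X).
have [gamma_ge gamma_le] := andP (domination_number_cycle_bounds hn).
(* All three formulas give the least [m] such that n + 2m reaches three times the target value. *)
have [m_gt1 m_le m_bounds] : [/\ 1 < m, m <= n &
    3 * (domination_number (cycle_graph n) + k) <= n + 2 * m
      <= 3 * (domination_number (cycle_graph n) + k) + 1].
  move: hnk; rewrite {}/m /ceil_divn /=.
  by case: eqP => n1; last case: eqP => n2; move=> hnk; split; lia.
clearbody m; apply/SbP; split=> [|E /andP[_ /eqP gammaE]].
  have [|E [subE cardE gammaE]] := @cut_consecutive_edges n hn m; first by lia.
  exists E => //; rewrite /raises_domination subE /=.
  (* Three times the new domination number lies between n + 2m - 2 and n + 2m; by [m_bounds], three
     times the target is the only multiple of 3 there. *)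
  by have := domination_number_del_cycle_le hn E; rewrite cardE; lia.
(* The bounds give [m <= maxn 1 #|E|], and [m_gt1] removes the maximum. *)
by have := domination_number_del_cycle_le hn E; rewrite gammaE; lia.
Qed.
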